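(* Let $A$ be an invertible $4\times 4$ matrix with entries in $k$, so that $X_A\subset\mathbb{P}^3$ is a smooth $k$-Hermitian surface. Then there is no nonplanar rational curve of degree $d\le q$ contained in $X_A$.
   Context: Let $p$ be a prime, $q$ a power of $p$, and $k$ an algebraic closure of $\mathbb{F}_q$. Points of the projective space $\mathbb{P}^3$ over $k$ are written as column vectors $x={}^{t}(x_0,x_1,x_2,x_3)$. For a matrix $m$ over $k$, $m^{(q)}$ denotes the matrix whose entries are the $q$-th powers of those of $m$. For a nonzero $4\times4$ matrix $A$ over $k$, the $k$-Hermitian surface is $X_A=\{x\in\mathbb{P}^3 : {}^{t}x\,A\,x^{(q)}=0\}$; it is smooth if and only if $A$ is invertible. For a positive integer $d$ and a $4\times(d+1)$ matrix $F$ over $k$ with $\mathrm{rank}(F)\ge 2$, the rational curve $C_F$ of degree $d$ is the image of the rational map $\mathbb{P}^1\to\mathbb{P}^3$, ${}^{t}(s,t)\mapsto F\,{}^{t}(s^d,s^{d-1}t,\dots,st^{d-1},t^d)$. It is called nonplanar if $\mathrm{rank}(F)=4$, i.e. it is not contained in any plane. *)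

(* Defs.v *)
From HB Require Import structures.
From mathcomp Require Import all_boot all_order all_algebra.

Set Implicit Arguments.
Unset Strict Implicit.
Unset Printing Implicit Defensive.

Import GRing.Theory.
Local Open Scope ring_scope.
Local Open Scope quotient_scope.

Section ProjectiveSpace.
Variables (k : fieldType) (n : nat).

Definition hcoord := {x : 'cV[k]_n.+1 | x != 0}.

(* Two nonzero columns are proportional iff they span the same line; see
   [proportionalP]. *)
Definition proportional : rel hcoord :=
  [rel x y | ((val x)^T == (val y)^T)%MS].

Lemma proportional_refl : reflexive proportional.
Proof. by move=> x; apply/andP; split; exact: submx_refl. Qed.

Lemma proportional_sym : symmetric proportional.
Proof. by move=> x y; exact: andbC. Qed.

Lemma proportional_trans : transitive proportional.
Proof.
move=> y x z /andP[xy yx] /andP[yz zy].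
by apply/andP; split; [exact: submx_trans yz | exact: submx_trans yx].
Qed.

Canonical proportional_equiv :=
  EquivRel proportional proportional_refl proportional_sym proportional_trans.

Definition proj := {eq_quot proportional}.

Lemma proportionalP (x y : hcoord) :
  reflect (exists2 c : k, c != 0 & val y = c *: val x) (proportional x y).
Proof.
apply: (iffP idP) => [/andP[_ /sub_rVP[c]] | [c c0 E]].
  rewrite -linearZ => /trmx_inj E; exists c => //.
  by apply: contraNneq (valP y) => c0; rewrite E c0 scale0r.
apply/andP; rewrite E linearZ; split; last exact: scalemx_sub.
have -> : (val x)^T = c^-1 *: (c *: (val x)^T) by rewrite scalerA mulVf ?scale1r.
exact: scalemx_sub.
Qed.

Lemma repr_hcoord (x : hcoord) :
  exists2 c : k, c != 0 & val (repr (\pi x : proj)) = c *: val x.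
Proof.
by apply/proportionalP; rewrite proportional_sym; apply/eqmodP; rewrite /= reprK.
Qed.

(* The point with homogeneous coordinates [v]; [None] when [v = 0]. *)
Definition point_of (v : 'cV[k]_n.+1) : option proj :=
  omap (fun x : hcoord => \pi x) (insub v).

Lemma point_ofZ (c : k) v : c != 0 -> point_of (c *: v) = point_of v.
Proof.
move=> c0; rewrite /point_of.
case: insubP => [y cv0 Ey | ]; last first.
  rewrite negbK scaler_eq0 (negPf c0) => /eqP->.
  by rewrite insubN // negbK.
case: insubP => [x _ Ex | ]; last first.
  by rewrite negbK => /eqP v0; rewrite v0 scaler0 eqxx in cv0.
congr Some; apply/esym/eqmodP/proportionalP; exists c => //.
by rewrite Ey Ex.
Qed.

End ProjectiveSpace.

Notation "''P[' k ]_ n" := (proj k n) (at level 8, n at level 2).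

Section HermitianSurface.
Variables (k : fieldType) (q : nat).

Definition frob_mx m n (M : 'M[k]_(m, n)) : 'M[k]_(m, n) :=
  map_mx (fun a => a ^+ q) M.

Definition hermitian_eq (A : 'M[k]_4) (x : 'cV[k]_4) : bool :=
  x^T *m A *m frob_mx x == 0.

Definition hermitian_surface (A : 'M[k]_4) : pred 'P[k]_3 :=
  fun P => hermitian_eq A (val (repr P)).

Lemma hermitian_surface_pi A (x : hcoord k 3) :
  hermitian_surface A (\pi x) = hermitian_eq A (val x).
Proof.
rewrite /hermitian_surface /hermitian_eq.
have [c c0 ->] := repr_hcoord x.
have -> : frob_mx (c *: val x) = c ^+ q *: frob_mx (val x).
  by apply/matrixP => i j; rewrite !mxE exprMn.
have -> : (c *: val x)^T = c *: (val x)^T by rewrite linearZ.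
rewrite -!scalemxAl -scalemxAr scalerA scaler_eq0.
by rewrite mulf_eq0 expf_eq0 (negPf c0) andbF.
Qed.

End HermitianSurface.

Section RationalCurve.
Variable k : fieldType.

Definition monomials d (u : 'cV[k]_2) : 'cV[k]_d.+1 :=
  \col_(i < d.+1) (u 0 0 ^+ (d - i) * u 1 0 ^+ i).

(* [None] at the common zeros of the four binary forms given by [F]. *)
Definition form_map d (F : 'M[k]_(4, d.+1)) (P : 'P[k]_1) : option 'P[k]_3 :=
  point_of (F *m monomials d (val (repr P))).

Lemma form_map_pi d (F : 'M[k]_(4, d.+1)) (u : hcoord k 1) :
  form_map F (\pi u) = point_of (F *m monomials d (val u)).
Proof.
rewrite /form_map; have [c c0 ->] := repr_hcoord u.
have -> : monomials d (c *: val u) = c ^+ d *: monomials d (val u).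
  apply/matrixP => i j; rewrite !mxE !exprMn mulrACA -exprD subnK //.
  by rewrite -ltnS.
by rewrite -scalemxAr point_ofZ // expf_neq0.
Qed.

(* [F] and [G] represent the same rational map when they agree wherever both
   are defined; over an infinite field, nonzero [F] and [G] are both defined at
   all but finitely many points. *)
Definition same_rational_map d e
    (F : 'M[k]_(4, d.+1)) (G : 'M[k]_(4, e.+1)) : Prop :=
  forall P y z, form_map F P = Some y -> form_map G P = Some z -> y = z.

(* The image is taken over the whole domain of definition of the rational map:
   at a common zero of the forms of [F], its value is computed by another
   representative [G]. *)
Definition rational_curve d (F : 'M[k]_(4, d.+1)) (y : 'P[k]_3) : Prop :=
  exists e (G : 'M[k]_(4, e.+1)),
    same_rational_map F G /\ exists P : 'P[k]_1, form_map G P = Some y.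

Lemma form_map_rational_curve d (F : 'M[k]_(4, d.+1)) P y :
  form_map F P = Some y -> rational_curve F y.
Proof.
move=> Fy; exists d, F; split; last by exists P.
by move=> Q y1 y2 -> [].
Qed.

Definition nonplanar d (F : 'M[k]_(4, d.+1)) : bool := \rank F == 4.

End RationalCurve.

(* Main.v *)
(** Write the curve as [f(t) = sum_i f_i t^i], where the [f_i] are the columns
    of [F]. Since [k] is infinite, the curve lies on the surface iff the
    polynomial [sum_(i,j) (f_i^T A f_j^(q)) t^(i+qj)] vanishes. As [i <= d <= q],
    an exponent [i+qj] with [0 < i < q] arises from only one pair [(i, j)], so
    [f_i^T A F^(q) = 0] for those [i]. Now [A F^(q)] has full row rank, hence
    [f_i = 0] unless [i = 0] or [i = d = q], and [F] has rank at most 2. *)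
Require Import Defs.
From mathcomp Require Import all_boot all_order all_algebra all_field.
From mathcomp Require Import zify.

Set Implicit Arguments.
Unset Strict Implicit.
Unset Printing Implicit Defensive.

Import GRing.Theory.
Local Open Scope ring_scope.

Section FrobeniusMatrix.
Variables (k : fieldType) (q : nat).
Hypothesis q_char : [pchar k].-nat q.

Let q_gt0 : (0 < q)%N. Proof. by case/andP: q_char. Qed.

(** As [q] is a product of characteristic primes of [k], [x ^+ q] is additive as well as
    multiplicative. *)
Lemma frob_mxM m n l (M : 'M[k]_(m, n)) (N : 'M[k]_(n, l)) :
  frob_mx q (M *m N) = frob_mx q M *m frob_mx q N.
Proof.
apply/matrixP => i j; rewrite !mxE.
under [RHS]eq_bigr => s _ do rewrite !mxE -exprMn.
apply: (big_morph (fun x : k => x ^+ q)) => [x y|]; first exact: exprDn_pchar.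
by rewrite expr0n gtn_eqF.
Qed.

Lemma frob_mx1 n : frob_mx q (1%:M : 'M[k]_n) = 1%:M.
Proof.
by apply/matrixP => i j; rewrite !mxE; case: eqP; rewrite ?expr1n // expr0n gtn_eqF.
Qed.

(** Frobenius carries a right inverse of [M] to a right inverse of [frob_mx q M]. *)
Lemma row_free_frob_mx m n (M : 'M[k]_(m, n)) :
  row_free M -> row_free (frob_mx q M).
Proof.
case/row_freeP => N MN; apply/row_freeP; exists (frob_mx q N).
by rewrite -frob_mxM MN frob_mx1.
Qed.

End FrobeniusMatrix.

Section CurveOnSurface.
Variables (k : closedFieldType) (q d : nat).
Implicit Types (A : 'M[k]_4) (F : 'M[k]_(4, d.+1)).

(** At a common zero of the forms of [F] the equation holds trivially, so no parameter [u] has to be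
    excluded. *)
Lemma hermitian_eq_rational_curve A F (u : 'cV[k]_2) :
    (0 < q)%N -> u != 0 ->
    (forall y, rational_curve F y -> hermitian_surface q A y) ->
  hermitian_eq q A (F *m monomials d u).
Proof.
move=> q_gt0 u0 sub; have [v0 | v0] := eqVneq (F *m monomials d u) 0.
  by rewrite v0 /hermitian_eq trmx0 !mul0mx.
have: form_map F (\pi_('P[k]_1) (exist _ u u0 : hcoord k 1))%qT
      = Some (\pi_('P[k]_3) (exist (fun x => x != 0) _ v0))%qT.
  by rewrite form_map_pi /point_of insubT.
by move/form_map_rational_curve/sub; rewrite hermitian_surface_pi.
Qed.

(** A nonzero polynomial over an algebraically closed field has a non-root. *)
Lemma sum_exp_eq0 (M : 'M[k]_d.+1) :
    (forall t, \sum_i \sum_j M i j * t ^+ (i + q * j) = 0) ->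
  \sum_i \sum_j M i j *: 'X^(i + q * j) = 0 :> {poly k}.
Proof.
move=> M0; apply/eqP/negPn/negP => /closed_nonrootP[t /negP[]].
apply/rootP; rewrite -[RHS](M0 t) horner_sum; apply: eq_bigr => i _.
by rewrite horner_sum; apply: eq_bigr => j _; rewrite hornerZ hornerXn.
Qed.

(** If [i + q * j = i' + q * j'] with [0 < i < q] and [0 <= i' <= q], then [i' - i] is a multiple of
    [q] lying strictly between [-q] and [q], hence zero. For [i = 0] or [i = q] carries can occur:
    [q + q * j = 0 + q * j.+1]. *)
Lemma coef_sum_exp (M : 'M[k]_d.+1) (i j : 'I_d.+1) :
    (d <= q)%N -> (0 < i < q)%N ->
  (\sum_i \sum_j M i j *: 'X^(i + q * j) : {poly k})`_(i + q * j) = M i j.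
Proof.
move=> dq iq.
have inj (i' j' : 'I_d.+1) :
    (i + q * j == i' + q * j')%N = (i' == i) && (j' == j).
  apply/eqP/andP => [E | [/eqP-> /eqP->] //].
  have i'q : (i' <= q)%N by rewrite (leq_trans _ dq) // -ltnS.
  have jj' : j = j' :> nat by nia.
  by rewrite -!val_eqE /=; split; apply/eqP; nia.
rewrite coef_sum (bigD1 i) //= coef_sum (bigD1 j) //=.
rewrite coefZ coefXn eqxx mulr1 !big1 ?addr0 // => [i' | j'] ne.
  rewrite coef_sum big1 // => j' _.
  by rewrite coefZ coefXn inj (negPf ne) mulr0.
by rewrite coefZ coefXn inj (negPf ne) andbF mulr0.
Qed.

(** The first and last rows of [F^T] span its row space, and each has rank at most 1. *)
Lemma rank_le2_ends F :
  (forall i : 'I_d.+1, (0 < i < d)%N -> col i F = 0) -> (\rank F <= 2)%N.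
Proof.
move=> F0; rewrite -mxrank_tr.
apply: leq_trans (leq_add (rank_leq_row (col ord0 F)^T)
                          (rank_leq_row (col ord_max F)^T)).
apply: leq_trans (mxrank_adds_leqif _ _).1.
apply/mxrankS/row_subP => i; rewrite -tr_col.
have [i0 | i_gt0] := posnP i.
  by rewrite (_ : i = ord0) ?addsmxSl //; apply: val_inj.
have [id | di] := ltnP i d; first by rewrite (F0 i) ?i_gt0 // trmx0 sub0mx.
rewrite (_ : i = ord_max) ?addsmxSr //; apply: val_inj => /=.
by apply/eqP; rewrite eqn_leq di -ltnS ltn_ord.
Qed.

Lemma rank_le2_curve_on_surface A F :
    [pchar k].-nat q -> (d <= q)%N -> A \in unitmx -> row_free F ->
    (forall y, rational_curve F y -> hermitian_surface q A y) ->
  (\rank F <= 2)%N.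
Proof.
move=> q_char dq A_unit F_free sub; have q_gt0 : (0 < q)%N by case/andP: q_char.
set M := F^T *m (A *m frob_mx q F).
have M0 t : \sum_i \sum_j M i j * t ^+ (i + q * j) = 0.
  (* In the chart [(1, t)] the monomial of index [i] is [t ^+ i], and Frobenius turns [t ^+ j] into
     [t ^+ (q * j)]. *)
  pose u : 'cV[k]_2 := \col_i t ^+ i.
  have u0 : u != 0.
    by apply/eqP => /matrixP/(_ 0 0)/eqP; rewrite !mxE expr0 oner_eq0.
  have /eqP/matrixP/(_ 0 0) := hermitian_eq_rational_curve q_gt0 u0 sub.
  rewrite frob_mxM // trmx_mul !mulmxA -[_ *m A *m _]mulmxA -[_ *m (A *m _)]mulmxA.
  rewrite -/M [RHS]mxE; apply: etrans; rewrite -mulmxA mxE; apply: eq_bigr => i _.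
  rewrite !mxE mulr_sumr; apply: eq_bigr => j _.
  by rewrite !mxE !expr0 !expr1 !expr1n !mul1r exprD mulrCA -exprM (mulnC j).
apply: rank_le2_ends => i /andP[i_gt0 id]; apply: trmx_inj; rewrite trmx0.
have B_free : row_free (A *m frob_mx q F).
  by rewrite /row_free mxrankMfree ?row_free_frob_mx // -/(row_free A) row_free_unit.
(* Cancelling [A *m frob_mx q F] on the right leaves row [i] of [M] to be shown zero; its entries
   are isolated coefficients because [i < d <= q]. *)
apply: (row_free_inj B_free); rewrite mul0mx tr_col -row_mul -/M.
apply/rowP => j; rewrite [LHS]mxE [RHS]mxE.
by rewrite -(coef_sum_exp M j dq) ?i_gt0 ?(leq_trans id) // sum_exp_eq0 // coef0.
Qed.

End CurveOnSurface.

Theorem theorem1p1 (p r q : nat) (p_prime : prime p) (r_gt0 : (0 < r)%N)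
    (q_def : q = (p ^ r)%N)
    (Fq : finFieldType) (card_Fq : #|Fq| = q)
    (k : closedFieldType) (iota : {rmorphism Fq -> k})
    (k_algebraic : forall x : k, algebraicOver iota x)
    (A : 'M[k]_4) (A_unit : A \in unitmx) :
  ~ exists (d : nat) (F : 'M[k]_(4, d.+1)),
      [/\ (0 < d <= q)%N,
          (2 <= \rank F)%N,
          nonplanar F
        & forall y : 'P[k]_3, rational_curve F y -> hermitian_surface q A y].
Proof.
case=> d [F [/andP[_ dq] _ /eqP F4 sub]].
have p_char : p \in [pchar k].
  (* The cardinality of [Fq] gives its characteristic, which [iota] transports to [k]. *)
  by apply: (rmorph_pchar iota); apply: (@card_finPcharP _ p r); rewrite ?card_Fq.
have q_char : [pchar k].-nat q.
  by rewrite (eq_pnat _ (pcharf_eq p_char)) q_def pnatX pnat_id.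
have F_free : row_free F by apply/eqP.
by have := rank_le2_curve_on_surface q_char dq A_unit F_free sub; rewrite F4.
Qed.
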